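(* Fix a formula $F$ and define, for every formula $A$, $N_1(A) :\equiv A^G \vee F$ and $N_2(A) :\equiv A^G[F/\bot]$ (the formula obtained from $A^G$ by replacing every occurrence of $\bot$ by $F$). Then for each $N \in \{N_1, N_2\}$: (1) for every formula $F$, $N$ has a soundness theorem into $\mathsf{ML}$, i.e. for all formulas $A$ and all sets $\Gamma$ of possibly open formulas, $\mathsf{CL} + \Gamma \vdash A$ implies $\mathsf{ML} + N(\Gamma) \vdash N(A)$, where $N(\Gamma) = \{N(B) : B \in \Gamma\}$; (2) $N$ has a characterisation theorem (i.e. $\mathsf{CL} \vdash N(A) \leftrightarrow A$ for all formulas $A$) if and only if $\mathsf{CL} \vdash \neg F$; (3) $N$ is equivalent in $\mathsf{IL}$ to the Gödel–Gentzen translation (i.e. $\mathsf{IL} \vdash N(A) \leftrightarrow A^G$ for all formulas $A$) if and only if $\mathsf{IL} \vdash \neg F$. Consequently, if $\mathsf{CL} \vdash \neg F$ but $\mathsf{IL} \nvdash \neg F$, then $N_1$ and $N_2$ are negative translations into $\mathsf{ML}$ that are not equivalent in $\mathsf{IL}$ to the Gödel–Gentzen translation.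
   Context: $\mathsf{CL}$ is pure first-order classical predicate logic based on $\bot, \wedge, \vee, \to, \forall, \exists$ (with $\neg A :\equiv A \to \bot$, $A\leftrightarrow B :\equiv (A\to B)\wedge(B\to A)$); $\mathsf{IL}$ and $\mathsf{ML}$ are its intuitionistic and minimal counterparts (in $\mathsf{ML}$, $\bot$ behaves as an arbitrary propositional constant). The Gödel–Gentzen translation $A \mapsto A^G$ is defined by induction: $P^G :\equiv \neg\neg P$ for atomic $P \not\equiv \bot$; $\bot^G :\equiv \bot$; $(A\wedge B)^G :\equiv A^G \wedge B^G$; $(A \vee B)^G :\equiv \neg(\neg A^G \wedge \neg B^G)$; $(A \to B)^G :\equiv A^G \to B^G$; $(\forall x A)^G :\equiv \forall x A^G$; $(\exists x A)^G :\equiv \neg\forall x \neg A^G$. A function $N$ from formulas to formulas is a negative translation into $\mathsf{ML}$ (resp. $\mathsf{IL}$) if it has a soundness theorem into $\mathsf{ML}$ (resp. $\mathsf{IL}$): for all formulas $A$ and all sets $\Gamma$ of possibly open formulas, $\mathsf{CL}+\Gamma \vdash A$ implies $\mathsf{ML} + N(\Gamma) \vdash N(A)$ (resp. $\mathsf{IL} + N(\Gamma)\vdash N(A)$); and a characterisation theorem: $\mathsf{CL} \vdash N(A) \leftrightarrow A$ for all formulas $A$. *)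

(* Defs.v *)
From mathcomp Require Import all_boot.
From mathcomp Require Import classical_sets.
From Stdlib Require List.

Set Implicit Arguments.
Unset Strict Implicit.
Unset Printing Implicit Defensive.

Local Open Scope classical_set_scope.

Record signature := Signature {
  fsym : Type;
  fsym_ar : fsym -> nat;
  psym : Type;
  psym_ar : psym -> nat
}.

(* Variables are de Bruijn indices: index 0 in the body of [All] and [Ex]
   refers to that quantifier, and the indices that exceed the number of
   enclosing quantifiers are the free variables. Formulas are thus identified
   up to renaming of bound variables. *)
Inductive term (S : signature) : Type :=
| Var of nat
| App (f : fsym S) of {ffun 'I_(fsym_ar f) -> term S}.

Arguments Var {S} _.

(* [Bot] is not an instance of [Atom]. *)
Inductive form (S : signature) : Type :=
| Bot
| Atom (P : psym S) of {ffun 'I_(psym_ar P) -> term S}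
| And of form S & form S
| Or of form S & form S
| Imp of form S & form S
| All of form S
| Ex of form S.

Arguments Bot {S}.

Definition Neg (S : signature) (A : form S) : form S := Imp A Bot.
Definition Iff (S : signature) (A B : form S) : form S :=
  And (Imp A B) (Imp B A).

Fixpoint tsubst (S : signature) (s : nat -> term S) (t : term S) : term S :=
  match t with
  | Var n => s n
  | App f ts => App [ffun i => tsubst s (ts i)]
  end.

Definition up (S : signature) (s : nat -> term S) (n : nat) : term S :=
  if n is m.+1 then tsubst (fun k => Var k.+1) (s m) else Var 0.

Fixpoint fsubst (S : signature) (s : nat -> term S) (A : form S) : form S :=
  match A with
  | Bot => Bot
  | Atom P ts => Atom [ffun i => tsubst s (ts i)]
  | And B C => And (fsubst s B) (fsubst s C)
  | Or B C => Or (fsubst s B) (fsubst s C)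
  | Imp B C => Imp (fsubst s B) (fsubst s C)
  | All B => All (fsubst (up s) B)
  | Ex B => Ex (fsubst (up s) B)
  end.

Definition shift (S : signature) (A : form S) : form S :=
  fsubst (fun k => Var k.+1) A.

Definition inst (S : signature) (t : term S) (A : form S) : form S :=
  fsubst (fun k => if k is m.+1 then Var m else t) A.

Inductive logic := ML | IL | CL.

(* Natural deduction. In [AllI] and [ExE], shifting the context (and the
   conclusion of [ExE]) makes index 0 fresh: this is the eigenvariable
   condition. *)
Inductive nd (S : signature) (L : logic) : seq (form S) -> form S -> Prop :=
| Ax G A : List.In A G -> nd L G A
| AndI G A B : nd L G A -> nd L G B -> nd L G (And A B)
| AndEl G A B : nd L G (And A B) -> nd L G A
| AndEr G A B : nd L G (And A B) -> nd L G B
| OrIl G A B : nd L G A -> nd L G (Or A B)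
| OrIr G A B : nd L G B -> nd L G (Or A B)
| OrE G A B C :
    nd L G (Or A B) -> nd L (A :: G) C -> nd L (B :: G) C -> nd L G C
| ImpI G A B : nd L (A :: G) B -> nd L G (Imp A B)
| ImpE G A B : nd L G (Imp A B) -> nd L G A -> nd L G B
| AllI G A : nd L (map (@shift S) G) A -> nd L G (All A)
| AllE G A t : nd L G (All A) -> nd L G (inst t A)
| ExI G A t : nd L G (inst t A) -> nd L G (Ex A)
| ExE G A C :
    nd L G (Ex A) -> nd L (A :: map (@shift S) G) (shift C) -> nd L G C
| Efq G A : L <> ML -> nd L G Bot -> nd L G A
| Raa G A : L = CL -> nd L (Neg A :: G) Bot -> nd L G A.

(* L + T |- A. The free variables of the members of T are parameters: they
   may not be generalised over. *)
Definition derives (S : signature) (L : logic) (T : set (form S))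
    (A : form S) : Prop :=
  exists2 G : seq (form S), (forall B, List.In B G -> T B) & nd L G A.

Definition provable (S : signature) (L : logic) (A : form S) : Prop :=
  derives L set0 A.

Fixpoint GG (S : signature) (A : form S) : form S :=
  match A with
  | Bot => Bot
  | Atom P ts => Neg (Neg (Atom ts))
  | And B C => And (GG B) (GG C)
  | Or B C => Neg (And (Neg (GG B)) (Neg (GG C)))
  | Imp B C => Imp (GG B) (GG C)
  | All B => All (GG B)
  | Ex B => Neg (All (Neg (GG B)))
  end.

(* A[F/Bot]. Shifting F under each quantifier prevents the capture of its
   free variables. *)
Fixpoint bot_subst (S : signature) (F A : form S) : form S :=
  match A with
  | Bot => F
  | Atom P ts => Atom ts
  | And B C => And (bot_subst F B) (bot_subst F C)
  | Or B C => Or (bot_subst F B) (bot_subst F C)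
  | Imp B C => Imp (bot_subst F B) (bot_subst F C)
  | All B => All (bot_subst (shift F) B)
  | Ex B => Ex (bot_subst (shift F) B)
  end.

Definition N1 (S : signature) (F A : form S) : form S := Or (GG A) F.
Definition N2 (S : signature) (F A : form S) : form S := bot_subst F (GG A).

Definition sound_into (S : signature) (L : logic) (N : form S -> form S) :
    Prop :=
  forall (T : set (form S)) (A : form S),
    derives CL T A -> derives L (N @` T) (N A).

Definition equivalent_in (S : signature) (L : logic)
    (N M : form S -> form S) : Prop :=
  forall A : form S, provable L (Iff (N A) (M A)).

Definition characterised (S : signature) (N : form S -> form S) : Prop :=
  forall A : form S, provable CL (Iff (N A) A).

Definition negative_translation (S : signature) (L : logic)
    (N : form S -> form S) : Prop :=
  sound_into L N /\ characterised N.

(* Main.v *)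
(** Soundness: A^G is stable in ML, so the Gödel-Gentzen translation maps CL
    into ML. Weakening conclusion and hypotheses to disjunctions with F, or
    substituting F for the constant Bot, which has no rule of its own in ML,
    gives N1 and N2. Both N(A) are equivalent to A^G once F <-> Bot is
    derivable, and N(Bot) <-> Bot forces this; that yields the criterion in IL,
    and in CL, where moreover A^G <-> A, the criterion for characterisation. *)
From mathcomp Require Import all_boot.
From mathcomp Require Import classical_sets.
From Stdlib Require List.
(* Imported last: [ssrfun] also defines [fsym]. *)
Require Import Defs.

Set Implicit Arguments.
Unset Strict Implicit.
Unset Printing Implicit Defensive.

(** * Substitution calculus on terms and formulas *)

(** The arguments of [App] are nested in a finite function; this principle supplies an induction
    hypothesis for each of them. *)
Lemma term_ffun_ind (S : signature) (P : term S -> Prop) :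
  (forall n, P (Var n)) ->
  (forall (f : fsym S) (ts : {ffun 'I_(fsym_ar f) -> term S}),
     (forall i, P (ts i)) -> P (App ts)) ->
  forall t, P t.
Proof.
move=> PVar PApp; fix IH 1; case=> [n|f ts]; first exact: PVar.
by apply: PApp => i; exact: IH.
Qed.

Lemma eq_tsubst (S : signature) (s r : nat -> term S) :
  s =1 r -> tsubst s =1 tsubst r.
Proof.
move=> sr; elim/term_ffun_ind=> [n|f ts IH] //=.
by congr App; apply/ffunP=> i; rewrite !ffunE.
Qed.

(** Terms bind no variables, so no lifting occurs here, and [up_comp] can be deduced from this
    composition law. *)
Lemma tsubst_comp (S : signature) (s r : nat -> term S) t :
  tsubst s (tsubst r t) = tsubst (fun k => tsubst s (r k)) t.
Proof.
elim/term_ffun_ind: t => [n|f ts IH] //=.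
by congr App; apply/ffunP=> i; rewrite !ffunE.
Qed.

Lemma tsubst_Var (S : signature) (t : term S) : tsubst Var t = t.
Proof.
elim/term_ffun_ind: t => [n|f ts IH] //=.
by congr App; apply/ffunP=> i; rewrite !ffunE.
Qed.

Lemma eq_up (S : signature) (s r : nat -> term S) : s =1 r -> up s =1 up r.
Proof. by move=> sr [|n] //=; rewrite sr. Qed.

Lemma up_comp (S : signature) (s r : nat -> term S) :
  (fun k => tsubst (up s) (up r k)) =1 up (fun k => tsubst s (r k)).
Proof. by case=> [|n] //=; rewrite !tsubst_comp. Qed.

Lemma eq_fsubst (S : signature) (s r : nat -> term S) (A : form S) :
  s =1 r -> fsubst s A = fsubst r A.
Proof.
elim: A s r => [|P ts|A IHA B IHB|A IHA B IHB|A IHA B IHB|A IHA|A IHA] s r sr //=.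
- by congr Atom; apply/ffunP=> i; rewrite !ffunE; exact: eq_tsubst.
- by rewrite (IHA _ _ sr) (IHB _ _ sr).
- by rewrite (IHA _ _ sr) (IHB _ _ sr).
- by rewrite (IHA _ _ sr) (IHB _ _ sr).
- by rewrite (IHA _ _ (eq_up sr)).
- by rewrite (IHA _ _ (eq_up sr)).
Qed.

Lemma fsubst_comp (S : signature) (s r : nat -> term S) (A : form S) :
  fsubst s (fsubst r A) = fsubst (fun k => tsubst s (r k)) A.
Proof.
elim: A s r => [|P ts|A IHA B IHB|A IHA B IHB|A IHA B IHB|A IHA|A IHA] s r //=.
- by congr Atom; apply/ffunP=> i; rewrite !ffunE tsubst_comp.
- by rewrite IHA IHB.
- by rewrite IHA IHB.
- by rewrite IHA IHB.
- by rewrite IHA (eq_fsubst _ (up_comp s r)).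
- by rewrite IHA (eq_fsubst _ (up_comp s r)).
Qed.

Lemma fsubst_Var (S : signature) (A : form S) : fsubst Var A = A.
Proof.
have upV : up (@Var S) =1 Var by case.
elim: A => [|P ts|A IHA B IHB|A IHA B IHB|A IHA B IHB|A IHA|A IHA] //=.
- by congr Atom; apply/ffunP=> i; rewrite !ffunE tsubst_Var.
- by rewrite IHA IHB.
- by rewrite IHA IHB.
- by rewrite IHA IHB.
- by rewrite (eq_fsubst _ upV) IHA.
- by rewrite (eq_fsubst _ upV) IHA.
Qed.

Lemma shift_fsubst (S : signature) (s : nat -> term S) (A : form S) :
  shift (fsubst s A) = fsubst (up s) (shift A).
Proof. by rewrite /shift !fsubst_comp. Qed.

Lemma inst_shift (S : signature) (t : term S) (A : form S) :
  inst t (shift A) = A.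
Proof. by rewrite /inst /shift fsubst_comp fsubst_Var. Qed.

(** Opening a shifted quantified formula at the eigenvariable, index 0, gives back its original
    body. *)
Lemma inst_Var0 (S : signature) (A : form S) :
  inst (Var 0) (fsubst (up (fun k => Var k.+1)) A) = A.
Proof.
by rewrite /inst fsubst_comp -[RHS]fsubst_Var; apply: eq_fsubst; case.
Qed.

(** * Commutation of the translations with substitution *)

Lemma GG_fsubst (S : signature) (s : nat -> term S) (A : form S) :
  GG (fsubst s A) = fsubst s (GG A).
Proof.
elim: A s => [|P ts|A IHA B IHB|A IHA B IHB|A IHA B IHB|A IHA|A IHA] s //=;
  by rewrite ?IHA ?IHB.
Qed.

Lemma bot_subst_fsubst (S : signature) (s : nat -> term S) (F A : form S) :
  bot_subst (fsubst s F) (fsubst s A) = fsubst s (bot_subst F A).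
Proof.
elim: A s F => [|P ts|A IHA B IHB|A IHA B IHB|A IHA B IHB|A IHA|A IHA] s F //=;
  by rewrite ?shift_fsubst ?IHA ?IHB.
Qed.

Lemma map_GG_shift (S : signature) (G : seq (form S)) :
  map (@GG S) (map (@shift S) G) = map (@shift S) (map (@GG S) G).
Proof. by rewrite -!map_comp; apply: eq_map => A /=; exact: GG_fsubst. Qed.

Lemma map_bot_subst_shift (S : signature) (F : form S) (G : seq (form S)) :
  map (bot_subst (shift F)) (map (@shift S) G) =
  map (@shift S) (map (bot_subst F) G).
Proof. by rewrite -!map_comp; apply: eq_map => A /=; exact: bot_subst_fsubst. Qed.

Lemma bot_subst_inst (S : signature) (F A : form S) (t : term S) :
  bot_subst F (inst t A) = inst t (bot_subst (shift F) A).
(* Reading [F] as [inst t (shift F)] puts the same substitution on both arguments. *)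
Proof. by rewrite -{1}(inst_shift t F) /inst bot_subst_fsubst. Qed.

(** * Weakening and derived rules *)

Lemma incl_cons2 (T : Type) (x : T) (s t : seq T) :
  List.incl s t -> List.incl (x :: s) (x :: t).
Proof. by move=> st y /= [->|/st]; [left|right]. Qed.

Lemma nd_weaken (S : signature) L (G D : seq (form S)) (A : form S) :
  List.incl G D -> nd L G A -> nd L D A.
Proof.
move=> GD dA; elim: dA D GD => {G A}.
- by move=> G A GA D GD; apply: Ax; exact: GD.
- by move=> G A B _ IHA _ IHB D GD; apply: AndI; auto.
- by move=> G A B _ IH D GD; apply: AndEl; exact: IH.
- by move=> G A B _ IH D GD; apply: AndEr; exact: IH.
- by move=> G A B _ IH D GD; apply: OrIl; exact: IH.
- by move=> G A B _ IH D GD; apply: OrIr; exact: IH.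
- move=> G A B C _ IH _ IHA _ IHB D GD.
  by apply: (OrE (IH _ GD)); [apply: IHA|apply: IHB]; exact: incl_cons2.
- by move=> G A B _ IH D GD; apply: ImpI; apply: IH; exact: incl_cons2.
- by move=> G A B _ IH _ IHA D GD; exact: ImpE (IH _ GD) (IHA _ GD).
- by move=> G A _ IH D GD; apply: AllI; apply: IH; exact: List.incl_map.
- by move=> G A t _ IH D GD; apply: AllE; exact: IH.
- by move=> G A t _ IH D GD; apply: ExI; exact: IH.
- move=> G A C _ IH _ IHC D GD; apply: (ExE (IH _ GD)); apply: IHC.
  by apply: incl_cons2; exact: List.incl_map.
- by move=> G A LM _ IH D GD; apply: Efq => //; exact: IH.
- by move=> G A LC _ IH D GD; apply: Raa => //; apply: IH; exact: incl_cons2.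
Qed.

Ltac ax := solve [apply: Ax => /=; intuition auto].
Ltac weaken d := solve [apply: nd_weaken d => ? /=; intuition auto].

(** Inside [AllI] or [ExE] a hypothesis [All A] has become [shift (All A)]; this eliminates it at
    the eigenvariable. *)
Lemma AllE0 (S : signature) L (G : seq (form S)) (A : form S) :
  nd L G (shift (All A)) -> nd L G A.
Proof. by move=> dA; rewrite -[A]inst_Var0; exact: AllE dA. Qed.

Lemma ExI0 (S : signature) L (G : seq (form S)) (A : form S) :
  nd L G A -> nd L G (shift (Ex A)).
Proof. by move=> dA; apply: (@ExI _ _ _ _ (Var 0)); rewrite inst_Var0. Qed.

(** * Congruence of provable equivalence *)

Lemma IffI (S : signature) L (G : seq (form S)) (A B : form S) :
  nd L (A :: G) B -> nd L (B :: G) A -> nd L G (Iff A B).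
Proof. by move=> dB dA; apply: AndI; exact: ImpI. Qed.

Lemma IffEl (S : signature) L (G : seq (form S)) (A B : form S) :
  nd L G (Iff A B) -> nd L G A -> nd L G B.
Proof. by move=> /AndEl; exact: ImpE. Qed.

Lemma IffEr (S : signature) L (G : seq (form S)) (A B : form S) :
  nd L G (Iff A B) -> nd L G B -> nd L G A.
Proof. by move=> /AndEr; exact: ImpE. Qed.

Lemma Iff_refl (S : signature) L (G : seq (form S)) (A : form S) :
  nd L G (Iff A A).
Proof. by apply: IffI; ax. Qed.

Lemma Iff_sym (S : signature) L (G : seq (form S)) (A B : form S) :
  nd L G (Iff A B) -> nd L G (Iff B A).
Proof. by move=> AB; apply: AndI; [exact: AndEr AB|exact: AndEl AB]. Qed.

Lemma Iff_trans (S : signature) L (G : seq (form S)) (A B C : form S) :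
  nd L G (Iff A B) -> nd L G (Iff B C) -> nd L G (Iff A C).
Proof.
move=> AB BC; apply: IffI.
- by apply: (@IffEl _ _ _ B); [weaken BC|apply: (@IffEl _ _ _ A); [weaken AB|ax]].
- by apply: (@IffEr _ _ _ _ B); [weaken AB|apply: (@IffEr _ _ _ _ C); [weaken BC|ax]].
Qed.

Lemma Iff_And (S : signature) L (G : seq (form S)) (A A' B B' : form S) :
  nd L G (Iff A A') -> nd L G (Iff B B') -> nd L G (Iff (And A B) (And A' B')).
Proof.
move=> HA HB; apply: IffI; apply: AndI.
- by apply: (@IffEl _ _ _ A); [weaken HA|apply: (@AndEl _ _ _ _ B); ax].
- by apply: (@IffEl _ _ _ B); [weaken HB|apply: (@AndEr _ _ _ A); ax].
- by apply: (@IffEr _ _ _ _ A'); [weaken HA|apply: (@AndEl _ _ _ _ B'); ax].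
- by apply: (@IffEr _ _ _ _ B'); [weaken HB|apply: (@AndEr _ _ _ A'); ax].
Qed.

Lemma Iff_Or (S : signature) L (G : seq (form S)) (A A' B B' : form S) :
  nd L G (Iff A A') -> nd L G (Iff B B') -> nd L G (Iff (Or A B) (Or A' B')).
Proof.
move=> HA HB; apply: IffI.
- apply: (@OrE _ _ _ A B); first ax.
  + by apply: OrIl; apply: (@IffEl _ _ _ A); [weaken HA|ax].
  + by apply: OrIr; apply: (@IffEl _ _ _ B); [weaken HB|ax].
- apply: (@OrE _ _ _ A' B'); first ax.
  + by apply: OrIl; apply: (@IffEr _ _ _ _ A'); [weaken HA|ax].
  + by apply: OrIr; apply: (@IffEr _ _ _ _ B'); [weaken HB|ax].
Qed.

Lemma Iff_Imp (S : signature) L (G : seq (form S)) (A A' B B' : form S) :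
  nd L G (Iff A A') -> nd L G (Iff B B') -> nd L G (Iff (Imp A B) (Imp A' B')).
Proof.
move=> HA HB; apply: IffI; apply: ImpI.
- apply: (@IffEl _ _ _ B); first weaken HB.
  by apply: (@ImpE _ _ _ A); [ax|apply: (@IffEr _ _ _ _ A'); [weaken HA|ax]].
- apply: (@IffEr _ _ _ _ B'); first weaken HB.
  by apply: (@ImpE _ _ _ A'); [ax|apply: (@IffEl _ _ _ A); [weaken HA|ax]].
Qed.

Lemma Iff_All (S : signature) L (G : seq (form S)) (A A' : form S) :
  nd L (map (@shift S) G) (Iff A A') -> nd L G (Iff (All A) (All A')).
Proof.
move=> HA; apply: IffI; apply: AllI => /=.
- by apply: (@IffEl _ _ _ A); [weaken HA|apply: AllE0; ax].
- by apply: (@IffEr _ _ _ _ A'); [weaken HA|apply: AllE0; ax].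
Qed.

Lemma Iff_Ex (S : signature) L (G : seq (form S)) (A A' : form S) :
  nd L (map (@shift S) G) (Iff A A') -> nd L G (Iff (Ex A) (Ex A')).
Proof.
move=> HA; apply: IffI.
- apply: (@ExE _ _ _ A); first ax; apply: ExI0 => /=.
  by apply: (@IffEl _ _ _ A); [weaken HA|ax].
- apply: (@ExE _ _ _ A'); first ax; apply: ExI0 => /=.
  by apply: (@IffEr _ _ _ _ A'); [weaken HA|ax].
Qed.

(* The equivalence is a hypothesis of the derivation, not a derivable formula:
   [AllI] then shifts it together with [F]. *)
Lemma bot_subst_equiv (S : signature) L (F A : form S) :
  nd L [:: Iff F Bot] (Iff (bot_subst F A) A).
Proof.
elim: A F => [|P ts|A IHA B IHB|A IHA B IHB|A IHA B IHB|A IHA|A IHA] F /=.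
- by ax.
- exact: Iff_refl.
- exact: Iff_And.
- exact: Iff_Or.
- exact: Iff_Imp.
- by apply: Iff_All; exact: IHA.
- by apply: Iff_Ex; exact: IHA.
Qed.

(** * Classical equivalence of A^G and A *)

Lemma Iff_NegNeg (S : signature) (G : seq (form S)) (A : form S) :
  nd CL G (Iff (Neg (Neg A)) A).
Proof.
apply: IffI.
- by apply: Raa => //; apply: (@ImpE _ _ _ (Neg A)); ax.
- by apply: ImpI; apply: (@ImpE _ _ _ A); ax.
Qed.

Lemma Iff_deMorgan_Or (S : signature) (G : seq (form S)) (A B : form S) :
  nd CL G (Iff (Neg (And (Neg A) (Neg B))) (Or A B)).
Proof.
apply: IffI.
- apply: Raa => //; apply: (@ImpE _ _ _ (And (Neg A) (Neg B))); first ax.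
  apply: AndI; apply: ImpI; apply: (@ImpE _ _ _ (Or A B)); try ax.
  + by apply: OrIl; ax.
  + by apply: OrIr; ax.
- apply: ImpI; apply: (@OrE _ _ _ A B); first ax.
  + by apply: (@ImpE _ _ _ A); [apply: (@AndEl _ _ _ _ (Neg B)); ax|ax].
  + by apply: (@ImpE _ _ _ B); [apply: (@AndEr _ _ _ (Neg A)); ax|ax].
Qed.

Lemma Iff_deMorgan_Ex (S : signature) (G : seq (form S)) (A : form S) :
  nd CL G (Iff (Neg (All (Neg A))) (Ex A)).
Proof.
apply: IffI.
- apply: Raa => //; apply: (@ImpE _ _ _ (All (Neg A))); first ax.
  apply: AllI; apply: ImpI; apply: (@ImpE _ _ _ (shift (Ex A))); first by ax.
  by apply: ExI0; ax.
- apply: ImpI; apply: (@ExE _ _ _ A); first ax.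
  by apply: (@ImpE _ _ _ A); [apply: AllE0; ax|ax].
Qed.

(** Every clause of [GG] is classically equivalent to the connective it replaces. The context stays
    arbitrary because the quantifier cases use the induction hypothesis in a shifted one. *)
Lemma GG_equiv (S : signature) (G : seq (form S)) (A : form S) :
  nd CL G (Iff (GG A) A).
Proof.
elim: A G => [|P ts|A IHA B IHB|A IHA B IHB|A IHA B IHB|A IHA|A IHA] G /=.
- exact: Iff_refl.
- exact: Iff_NegNeg.
- exact: Iff_And.
- by apply: Iff_trans (Iff_deMorgan_Or _ _ _) _; exact: Iff_Or.
- exact: Iff_Imp.
- exact: Iff_All.
- by apply: Iff_trans (Iff_deMorgan_Ex _ _) _; exact: Iff_Ex.
Qed.

(** * Stability and soundness of the Gödel-Gentzen translation *)

(** Contraposes A -> ¬¬A, which is minimally valid. It settles stability wherever [GG] produces a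
    negation: atoms, disjunctions and existentials. *)
Lemma NegNegNeg (S : signature) L (G : seq (form S)) (A : form S) :
  nd L G (Neg (Neg (Neg A))) -> nd L G (Neg A).
Proof.
move=> dA; apply: ImpI; apply: (@ImpE _ _ _ (Neg (Neg A))); first weaken dA.
by apply: ImpI; apply: (@ImpE _ _ _ A); ax.
Qed.

Lemma NegNeg_map (S : signature) L (G : seq (form S)) (A B : form S) :
  nd L (A :: G) B -> nd L G (Neg (Neg A)) -> nd L G (Neg (Neg B)).
Proof.
move=> AB dA; apply: ImpI; apply: (@ImpE _ _ _ (Neg A)); first weaken dA.
by apply: ImpI; apply: (@ImpE _ _ _ B); [ax|weaken AB].
Qed.

(** A^G is built from [Bot] and negations by [And], [Imp] and [All], and these connectives preserve
    stability in minimal logic: the double negation of the whole yields that of each component by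
    [NegNeg_map]. *)
Lemma GG_stable_ax (S : signature) L (A : form S) :
  nd L [:: Neg (Neg (GG A))] (GG A).
Proof.
(* The induction hypotheses have a one-formula context; this transports them to any context. *)
have cut B (G : seq (form S)) : nd L [:: Neg (Neg (GG B))] (GG B) ->
    nd L G (Neg (Neg (GG B))) -> nd L G (GG B).
  move=> stB; apply: ImpE; apply: ImpI; weaken stB.
elim: A => [|P ts|A IHA B IHB|A IHA B IHB|A IHA B IHB|A IHA|A IHA] /=.
- by apply: (@ImpE _ _ _ (Neg Bot)); [ax|apply: ImpI; ax].
- by apply: NegNegNeg; ax.
- apply: AndI; apply: cut => //; apply: (@NegNeg_map _ _ _ (And (GG A) (GG B))); try ax.
  + by apply: (@AndEl _ _ _ _ (GG B)); ax.
  + by apply: (@AndEr _ _ _ (GG A)); ax.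
- by apply: NegNegNeg; ax.
- apply: ImpI; apply: cut => //.
  apply: (@NegNeg_map _ _ _ (Imp (GG A) (GG B))); last ax.
  by apply: (@ImpE _ _ _ (GG A)); ax.
- apply: AllI => /=; apply: cut => //.
  apply: (@NegNeg_map _ _ _ (shift (All (GG A)))); last ax.
  by apply: AllE0; ax.
- by apply: NegNegNeg; ax.
Qed.

(** Reductio for translated formulas, available even in [ML]; it stands in for [Efq] and [Raa]. *)
Lemma GG_stable (S : signature) L (G : seq (form S)) (A : form S) :
  nd L (Neg (GG A) :: G) Bot -> nd L G (GG A).
Proof.
move=> /ImpI; apply: ImpE; apply: ImpI; weaken (GG_stable_ax L A).
Qed.

Lemma GG_sound (S : signature) L (G : seq (form S)) (A : form S) :
  nd L G A -> nd ML (map (@GG S) G) (GG A).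
Proof.
elim=> {G A} /=.
- by move=> G A GA; apply: Ax; exact: List.in_map.
- by move=> G A B _ IHA _ IHB; exact: AndI.
- by move=> G A B _; exact: AndEl.
- by move=> G A B _; exact: AndEr.
- move=> G A B _ IH; apply: ImpI; apply: (@ImpE _ _ _ (GG A)); last weaken IH.
  by apply: (@AndEl _ _ _ _ (Neg (GG B))); ax.
- move=> G A B _ IH; apply: ImpI; apply: (@ImpE _ _ _ (GG B)); last weaken IH.
  by apply: (@AndEr _ _ _ (Neg (GG A))); ax.
(* Reductio on C^G: assuming ¬C^G, each branch refutes its disjunct, against the translated
   disjunction. *)
- move=> G A B C _ IH _ IHA _ IHB; apply: GG_stable.
  apply: (@ImpE _ _ _ (And (Neg (GG A)) (Neg (GG B)))); first weaken IH.
  apply: AndI; apply: ImpI; apply: (@ImpE _ _ _ (GG C)); try ax.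
  + weaken IHA.
  + weaken IHB.
- by move=> G A B _; exact: ImpI.
- by move=> G A B _ IH _; exact: ImpE.
- by move=> G A _; rewrite map_GG_shift; exact: AllI.
- by move=> G A t _ IH; rewrite /inst GG_fsubst; exact: AllE.
- move=> G A t _; rewrite /inst GG_fsubst => IH; apply: ImpI.
  apply: (@ImpE _ _ _ (inst t (GG A))); last weaken IH.
  by apply: (@AllE _ _ _ (Neg (GG A))); ax.
(* As for disjunction, with the refutation of A^G generalised over the eigenvariable. *)
- move=> G A C _ IH _; rewrite map_GG_shift GG_fsubst => IHC; apply: GG_stable.
  apply: (@ImpE _ _ _ (All (Neg (GG A)))); first weaken IH.
  apply: AllI; apply: ImpI; apply: (@ImpE _ _ _ (shift (GG C))); first by ax.
  weaken IHC.
- by move=> G A _ _ IH; apply: GG_stable; weaken IH.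
- by move=> G A _ _; exact: GG_stable.
Qed.

(** * Passing from A^G to the two variants *)

(** The induction keeps [F] general: in the shifted premises of [AllI] and [ExE], it is [shift F]
    that replaces [Bot]. *)
Lemma bot_subst_sound (S : signature) (F : form S) (G : seq (form S))
    (A : form S) :
  nd ML G A -> nd ML (map (bot_subst F) G) (bot_subst F A).
Proof.
move=> dA; elim: dA F => {G A} /=.
- by move=> G A GA F; apply: Ax; exact: List.in_map.
- by move=> G A B _ IHA _ IHB F; exact: AndI.
- by move=> G A B _ IH F; exact: AndEl (IH F).
- by move=> G A B _ IH F; exact: AndEr (IH F).
- by move=> G A B _ IH F; exact: OrIl.
- by move=> G A B _ IH F; exact: OrIr.
- by move=> G A B C _ IH _ IHA _ IHB F; exact: OrE (IH F) (IHA F) (IHB F).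
- by move=> G A B _ IH F; exact: ImpI (IH F).
- by move=> G A B _ IH _ IHA F; exact: ImpE (IH F) (IHA F).
- by move=> G A _ IH F; apply: AllI; rewrite -map_bot_subst_shift.
- by move=> G A t _ IH F; rewrite bot_subst_inst; exact: AllE (IH F).
- by move=> G A t _ IH F; apply: (@ExI _ _ _ _ t); rewrite -bot_subst_inst.
- move=> G A C _ IH _ IHC F; apply: (ExE (IH F)).
  by rewrite -map_bot_subst_shift /shift -bot_subst_fsubst; exact: IHC.
(* The side conditions of [Efq] and [Raa] fail at [ML]. *)
- by [].
- by [].
Qed.

(** The derivation is used as a whole, not by induction on its rules: each hypothesis [Or B F] is
    split, the case [F] giving the conclusion at once and the case [B] restoring the original
    hypothesis. *)
Lemma Or_context (S : signature) L (F : form S) (G : seq (form S))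
    (A : form S) :
  nd L G A -> nd L (map (fun B => Or B F) G) (Or A F).
Proof.
(* [D] collects the disjuncts already extracted, so that hypotheses are split one at a time. *)
have gen (D : seq (form S)) :
    nd L (G ++ D) (Or A F) -> nd L (map (fun B => Or B F) G ++ D) (Or A F).
  elim: G D => [|B G IH] D //= d.
  apply: (@OrE _ _ _ B F); [ax| |by apply: OrIr; ax].
  have {}d : nd L (G ++ B :: D) (Or A F).
    apply: nd_weaken d => C /=; rewrite !List.in_app_iff /=; tauto.
  apply: nd_weaken (IH _ d) => C /=; rewrite !List.in_app_iff /=; tauto.
by move=> dA; have := gen [::]; rewrite !cats0; apply; exact: OrIl.
Qed.

(** * Soundness, characterisation and equivalence for N1 and N2 *)

Lemma provableP (S : signature) L (A : form S) :
  provable L A <-> nd L [::] A.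
Proof.
split=> [[[|B G] GP dA] //|dA]; last by exists [::].
by case: (GP B); left.
Qed.

(** A derivation uses finitely many members of the theory, so finite contexts suffice. *)
Lemma sound_into_map (S : signature) L (N : form S -> form S) :
  (forall G A, nd CL G A -> nd L (map N G) (N A)) -> sound_into L N.
Proof.
move=> soundN T A [G GT dA]; exists (map N G); last exact: soundN.
by move=> _ /List.in_map_iff[B [<- /GT TB]]; exists B.
Qed.

Lemma N1_sound (S : signature) (F : form S) : sound_into ML (N1 F).
Proof.
apply: sound_into_map => G A /GG_sound /(Or_context F).
by rewrite -map_comp.
Qed.

Lemma N2_sound (S : signature) (F : form S) : sound_into ML (N2 F).
Proof.
apply: sound_into_map => G A /GG_sound /(bot_subst_sound F).
by rewrite -map_comp.
Qed.

Lemma N1_equiv (S : signature) L (F A : form S) :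
  L <> ML -> nd L [::] (Neg F) -> nd L [::] (Iff (N1 F A) (GG A)).
Proof.
move=> LM nF; apply: IffI; last by apply: OrIl; ax.
apply: (@OrE _ _ _ (GG A) F); [ax|ax|].
by apply: Efq => //; apply: (@ImpE _ _ _ F); [weaken nF|ax].
Qed.

Lemma N2_equiv (S : signature) L (F A : form S) :
  L <> ML -> nd L [::] (Neg F) -> nd L [::] (Iff (N2 F A) (GG A)).
Proof.
(* Cut on [Iff F Bot], the hypothesis of [bot_subst_equiv]; its half Bot -> F is [Efq], whence the
   exclusion of [ML]. *)
move=> LM nF; apply: (@ImpE _ _ _ (Iff F Bot)).
  by apply: ImpI; exact: bot_subst_equiv.
by apply: AndI => //; apply: ImpI; apply: Efq => //; ax.
Qed.

(** Keeping [L] general covers both criteria: [IL] gives the equivalence one, [CL] the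
    characterisation one through [characterised_equiv]. *)
Lemma N_equiv (S : signature) L (F : form S) (N : form S -> form S) :
  N = N1 F \/ N = N2 F -> L <> ML ->
  equivalent_in L N (@GG S) <-> provable L (Neg F).
Proof.
move=> hN LM; split=> [/(_ Bot)|] /provableP.
  move=> eqN; apply/provableP/ImpI.
  apply: (@IffEl _ _ _ (N Bot)); first weaken eqN.
  (* [F] is the right disjunct of [N1 F Bot] and is [N2 F Bot] itself. *)
  by case: hN => ->; [apply: OrIr|]; ax.
move=> nF A; apply/provableP.
by case: hN => ->; [exact: N1_equiv|exact: N2_equiv].
Qed.

Lemma characterised_equiv (S : signature) (N : form S -> form S) :
  characterised N <-> equivalent_in CL N (@GG S).
Proof.
split=> eqN A; apply/provableP; have /provableP eqNA := eqN A.
- by apply: Iff_trans eqNA _; apply: Iff_sym; exact: GG_equiv.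
- by apply: Iff_trans eqNA _; exact: GG_equiv.
Qed.

Theorem theorem1 (S : signature) (F : form S) (N : form S -> form S)
    (hN : N = N1 F \/ N = N2 F) :
  sound_into ML N /\
  (characterised N <-> provable CL (Neg F)) /\
  (equivalent_in IL N (@GG S) <-> provable IL (Neg F)) /\
  (provable CL (Neg F) -> ~ provable IL (Neg F) ->
     negative_translation ML N /\ ~ equivalent_in IL N (@GG S)).
Proof.
have soundN : sound_into ML N.
  by case: hN => ->; [exact: N1_sound|exact: N2_sound].
have charN : characterised N <-> provable CL (Neg F).
  by apply: iff_trans (characterised_equiv N) _; exact: N_equiv.
have eqN : equivalent_in IL N (@GG S) <-> provable IL (Neg F) by exact: N_equiv.
by split=> //; split=> //; split=> // nF nnF; split; [split=> //; exact/charN|move/eqN].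
Qed.
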